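(* Let $G$ be a finite group, $N$ a normal subgroup of $G$, and $\mathbb{K}$ a splitting field for $G$ whose characteristic does not divide $|G|$. Let $k$ be the number of equivalence classes of irreducible $\mathbb{K}[G]$-modules with respect to $N$. For each $i=1,\dots,k$ let $\{V_{i1},\dots,V_{is_i}\}$ be a complete system of pairwise non-isomorphic irreducible $\mathbb{K}[G]$-modules in the $i$-th equivalence class, and put $$T_i:=H_{\mathbb{K}[G]}(V_{i1})\oplus\cdots\oplus H_{\mathbb{K}[G]}(V_{is_i}),\qquad L_i:=T_i\cap\mathbb{K}[N].$$ Then: (a) $\mathbb{K}[N]=L_1\oplus\cdots\oplus L_k$. (b) $\mathbf{Z}(\mathbb{K}[G])\cap\mathbb{K}[N]=(L_1\cap\mathbf{Z}(T_1))\oplus\cdots\oplus(L_k\cap\mathbf{Z}(T_k))$. (c) $\dim_{\mathbb{K}}(L_i\cap\mathbf{Z}(T_i))=1$ for every $i=1,\dots,k$. (d) $\dim_{\mathbb{K}}(\mathbf{Z}(\mathbb{K}[G])\cap\mathbb{K}[N])=k$, and $k$ is equal to the number of non-isomorphic minimal $G$-invariant $\mathbb{K}[N]$-modules, as well as to the number of orbits in the action by conjugation of $G$ on the set of (isomorphism classes of) irreducible $\mathbb{K}[N]$-modules.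
   Context: All groups are finite; modules are right modules of finite dimension over $\mathbb{K}$. $\mathbb{K}$ is a splitting field for $G$ if $\mathrm{End}_{\mathbb{K}[G]}(V)\cong\mathbb{K}$ for every irreducible $\mathbb{K}[G]$-module $V$. For an algebra $A$ and an irreducible $A$-module $M$, $H_A(M)$ denotes the $M$-homogeneous component of the regular module $A$, i.e. the sum of all $A$-submodules of $A$ (under right multiplication) isomorphic to $M$. Each $T_i$ is a two-sided ideal of $\mathbb{K}[G]$ and $L_i$ is a two-sided ideal of $\mathbb{K}[N]$. $\mathbf{Z}(A)=\{x\in A\mid xy=yx \text{ for all } y\in A\}$ is the center of $A$, and $\mathbf{Z}(T_i)$ is the center of $T_i$ as an algebra. Equivalence with respect to $N$: two irreducible $\mathbb{K}[G]$-modules $V,U$ are equivalent with respect to $N$ if the restrictions $V_N$ and $U_N$ to $\mathbb{K}[N]$ have a common irreducible $\mathbb{K}[N]$-submodule up to isomorphism (this is an equivalence relation, by Clifford's theorem). Conjugate module: for a $\mathbb{K}[N]$-module $W$ and $g\in G$, $W^g$ is the $\mathbb{K}[N]$-module whose underlying vector space is a copy $\overline{W}$ of $W$ with action $\overline{w}\,n=\overline{w(gng^{-1})}$ for $w\in W$, $n\in N$. $W$ is $G$-invariant if $W^g\cong W$ for all $g\in G$. A minimal $G$-invariant $\mathbb{K}[N]$-module is a nonzero $G$-invariant $\mathbb{K}[N]$-module with no nonzero proper $G$-invariant submodule. Conjugation $W\mapsto W^g$ defines an action of $G$ on the set of isomorphism classes of irreducible $\mathbb{K}[N]$-modules. *)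

(* Defs.v *)
From HB Require Import structures.
From mathcomp Require Import boolp classical_sets.
From mathcomp Require Import all_boot all_order all_algebra all_fingroup.
From mathcomp Require Import all_solvable.
From mathcomp Require Import mxrepresentation character.

Set Implicit Arguments.
Unset Strict Implicit.
Unset Printing Implicit Defensive.

Import GroupScope GRing.Theory.
Local Open Scope ring_scope.

(* A right F[G]-module of dimension n is a matrix representation
   [rV : mx_representation F G n], with g acting on row vectors by
   v |-> v *m rV g; [representation F G] bundles the dimension.  Isomorphism of
   modules is [mx_rsim], submodules are the row spaces U with [mxmodule rV U],
   and [submod_repr] turns such a U into a representation.

   The group algebra F[G] is [group_ring F G], the span of the matrices by which
   G acts on the right regular module 'rV_#|G| = [regular_repr F G].  A row
   vector u of the regular module corresponds to the element of
   [group_ring F G] encoded by [u *m group_ring F G]. *)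

Section SumOfSubspaces.

Variables (F : fieldType) (n : nat).

Definition is_mxsup (P : 'M[F]_n -> Prop) (H : 'M[F]_n) : Prop :=
  forall K : 'M[F]_n, (H <= K)%MS <-> (forall U, P U -> (U <= K)%MS).

(* The sum of a possibly infinite family of subspaces. *)
Definition mxsup (P : 'M[F]_n -> Prop) : 'M[F]_n :=
  xget 0 [set H | is_mxsup P H]%classic.

Lemma mxsupP (P : 'M[F]_n -> Prop) : is_mxsup P (mxsup P).
Proof.
pose fsum (s : seq 'M[F]_n) := (\sum_(U <- s) U)%MS.
pose R r := `[< exists s, (forall U, U \in s -> P U) /\ \rank (fsum s) = r >].
have exR : exists r, R r by exists (\rank (fsum [::])); apply/asboolP; exists [::].
have leR r : R r -> (r <= n)%N by move/asboolP=> [s [_ <-]]; exact: rank_leq_row.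
case: (ex_maxnP exR leR) => r /asboolP[s [Ps rs]] maxr.
suff supH : is_mxsup P (fsum s) by rewrite /mxsup; case: xgetP => // /(_ _ supH).
move=> K; split=> [sK U PU | PK].
  apply: submx_trans sK; have sub : (fsum s <= U + fsum s)%MS by rewrite addsmxSr.
  suff : (U + fsum s <= fsum s)%MS by apply: submx_trans; rewrite addsmxSl.
  rewrite -(geq_leqif (mxrank_leqif_sup sub)) rs; apply: maxr; apply/asboolP.
  exists (U :: s); split; last by rewrite /fsum big_cons.
  by move=> V; rewrite inE => /predU1P[-> | /Ps].
rewrite /fsum big_seq; elim/big_rec: _ => [|U V /Ps/PK UK VK]; first exact: sub0mx.
by rewrite addsmx_sub UK.
Qed.

End SumOfSubspaces.

Section Modules.

Variables (F : fieldType) (gT : finGroupType).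

Definition nonzero_mod (G : {group gT}) (V : representation F G) : Prop :=
  (0 < rdegree V)%N.

(* End_{F[G]}(V) contains the scalars, so it is isomorphic to F as an F-algebra
   exactly when it consists of scalars.  The library's [group_splitting_field]
   asks for absolute irreducibility instead. *)
Definition splitting_field (G : {group gT}) : Prop :=
  forall V : representation F G, mx_irreducible V ->
  forall f : 'M[F]_(rdegree V), centgmx V f -> is_scalar_mx f.

Definition iso_submodule (G : {group gT}) m (rW : mx_representation F G m)
    n (rV : mx_representation F G n) : Prop :=
  exists (U : 'M[F]_n) (modU : mxmodule rV U), mx_rsim rW (submod_repr modU).

Definition equiv_wrt (G N : {group gT}) (sNG : N \subset G)
    (V U : representation F G) : Prop :=
  exists W : representation F N,
    [/\ mx_irreducible W, iso_submodule W (subg_repr V sNG)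
      & iso_submodule W (subg_repr U sNG)].

Section Conjugate.

Variables (N : {group gT}) (n : nat) (rW : mx_representation F N n).
Variables (g : gT) (nNg : g \in 'N(N)%g).

Definition conj_repr_mx (x : gT) : 'M[F]_n := rW (g * x * g^-1)%g.

Lemma conj_repr_subproof : mx_repr N conj_repr_mx.
Proof.
have memN x : x \in N -> (g * x * g^-1)%g \in N.
  by move=> Nx; rewrite -mulgA -{1}(invgK g) -conjgE memJ_norm ?groupV.
split=> [|x y Nx Ny]; first by rewrite /conj_repr_mx mulg1 mulgV repr_mx1.
rewrite /conj_repr_mx -repr_mxM ?memN //; congr (rW _).
by rewrite !mulgA mulgKV.
Qed.

Definition conj_repr : mx_representation F N n :=
  MxRepresentation conj_repr_subproof.

End Conjugate.

Section Invariant.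

Variables (G N : {group gT}) (nNG : N <| G).

Definition conj_mod n (rW : mx_representation F N n) (g : gT) (Gg : g \in G) :
    mx_representation F N n :=
  conj_repr rW (fintype.subsetP (normal_norm nNG) g Gg).

Definition G_invariant n (rW : mx_representation F N n) : Prop :=
  forall (g : gT) (Gg : g \in G), mx_rsim (conj_mod rW Gg) rW.

Definition minimal_G_invariant (W : representation F N) : Prop :=
  [/\ nonzero_mod W, G_invariant W
    & forall (U : 'M[F]_(rdegree W)) (modU : mxmodule W U),
        U != 0 -> G_invariant (submod_repr modU) -> (1%:M <= U)%MS].

(* The isomorphism classes of W and W' lie in the same G-orbit. *)
Definition same_G_orbit (W W' : representation F N) : Prop :=
  exists (g : gT) (Gg : g \in G), mx_rsim (conj_mod W Gg) W'.

End Invariant.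

(* F[N] inside F[G]. *)
Definition subgroup_ring (G N : {group gT}) (sNG : N \subset G) :
    'A[F]_(#|N|, #|G|) :=
  enveloping_algebra_mx (subg_repr (regular_repr F G) sNG).

(* H_{F[G]}(V), as a subspace of the regular module. *)
Definition homogeneous_component (G : {group gT}) (V : representation F G) :
    'M[F]_#|G| :=
  mxsup (fun U : 'M[F]_#|G| =>
    exists modU : mxmodule (regular_repr F G) U, mx_rsim V (submod_repr modU)).

(* H_{F[G]}(V), as a subspace of [group_ring F G]. *)
Definition homogeneous_ideal (G : {group gT}) (V : representation F G) :
    'A[F]_(#|G| ^ 2, #|G|) :=
  <<homogeneous_component V *m group_ring F G>>%MS.

End Modules.

Arguments subgroup_ring F {gT G N} sNG.

(* For E an equivalence relation on {x | P x}: E has exactly k classes. *)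
Definition number_of_classes (T : Type) (P : T -> Prop) (E : T -> T -> Prop)
    (k : nat) : Prop :=
  exists f : 'I_k -> T,
    [/\ forall i, P (f i),
        forall i j, E (f i) (f j) -> i = j
      & forall x, P x -> exists i, E (f i) x].

(* Main.v *)
Require Import Defs.
From mathcomp Require Import boolp.
From mathcomp Require Import all_boot all_order all_algebra all_fingroup.
From mathcomp Require Import all_solvable.
From mathcomp Require Import mxrepresentation character.

(* Let e_i be the sum of the primitive central idempotents of K[G] attached to
   the i-th class, so that T_i = K[G] e_i.  A simple K[N]-submodule U of K[G]
   satisfies U e_i = 0 or U e_i = U: if U e_i and U e_i' are both nonzero, then U
   embeds in the restrictions of irreducible modules of the classes i and i', so
   i = i'.  As K[N] is a sum of simple modules, K[N] e_i <= K[N], i.e. e_i lies in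
   K[N], which gives (a) and (b).  A central z of K[G] in K[N] e_i acts on each
   V_ij by a scalar, and the same scalar for two of them because it can be read
   off on a common K[N]-submodule; hence z is a multiple of e_i, which is (c).
   For (d), Clifford's theorem identifies the classes with the G-orbits of
   irreducible K[N]-modules, and a minimal G-invariant module containing W is
   isomorphic to the direct sum of one copy of each conjugate of W. *)

Set Implicit Arguments.
Unset Strict Implicit.
Unset Printing Implicit Defensive.

Import GroupScope GRing.Theory.
Local Open Scope ring_scope.

(** Simple submodules and socles over a general field come under [classically], which eliminates
    into booleans; [asboolP] makes every goal boolean. *)
Lemma classically_Prop (P : Type) (Q : Prop) :
  classically P -> (P -> Q) -> Q.
Proof.
by move=> cP PQ; apply/asboolP; apply: cP => p; apply/asboolP/PQ.
Qed.

(** * Module homomorphisms as intertwining matrices *)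

Section Intertwiners.

Variables (F : fieldType) (gT : finGroupType) (G : {group gT}).

(** Vectors are rows: [B] is the homomorphism sending [v] to [v *m B], injective exactly when
    [row_free B]. *)
Definition intertwines m (rW : mx_representation F G m)
    n (rV : mx_representation F G n) (B : 'M[F]_(m, n)) : Prop :=
  forall x, x \in G -> rW x *m B = B *m rV x.

Lemma row_free_mul m n p (B : 'M[F]_(m, n)) (C : 'M_(n, p)) :
  row_free B -> row_free C -> row_free (B *m C).
Proof. by move=> fB fC; rewrite /row_free mxrankMfree. Qed.

Lemma intertwines_mul m (rW : mx_representation F G m)
    n (rV : mx_representation F G n) p (rU : mx_representation F G p) B C :
  intertwines rW rV B -> intertwines rV rU C -> intertwines rW rU (B *m C).
Proof. by move=> hB hC x Gx; rewrite mulmxA hB // -!mulmxA hC. Qed.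

Lemma intertwines_sum m (rW : mx_representation F G m)
    n (rV : mx_representation F G n) (a : gT -> F) B :
  intertwines rW rV B ->
  (\sum_(x in G) a x *: rW x) *m B = B *m (\sum_(x in G) a x *: rV x).
Proof.
move=> hB; rewrite mulmx_suml mulmx_sumr; apply: eq_bigr => x Gx.
by rewrite -scalemxAl hB // scalemxAr.
Qed.

Lemma val_submod_intertwines n (rV : mx_representation F G n) (U : 'M_n)
    (modU : mxmodule rV U) :
  intertwines (submod_repr modU) rV (val_submod 1%:M).
Proof.
move=> x Gx; have := val_submodJ modU 1%:M Gx.
by rewrite mul1mx => <-; rewrite -val_submodE.
Qed.

Lemma val_submod1_free n (U : 'M[F]_n) : row_free (val_submod (1%:M : 'M_(\rank U))).
Proof. by rewrite /row_free val_submod1. Qed.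

(** Schur: the kernel of [B] is a submodule, and were it nonzero it would be everything, making [B]
    zero. *)
Lemma irr_intertwines_free m (rW : mx_representation F G m)
    n (rV : mx_representation F G n) B :
  mx_irreducible rW -> intertwines rW rV B -> B != 0 -> row_free B.
Proof.
move=> irrW hB nzB; rewrite -kermx_eq0; apply: contraNT nzB => nzK.
have [_ _ minW] := irrW.
have modK : mxmodule rW (kermx B).
  apply/mxmoduleP => x Gx; apply/sub_kermxP.
  by rewrite -mulmxA hB // mulmxA mulmx_ker mul0mx.
have : (1%:M <= kermx B)%MS by apply: minW; rewrite ?submx1.
by move/sub_kermxP; rewrite mul1mx => ->.
Qed.

Lemma intertwines_module m (rW : mx_representation F G m)
    n (rV : mx_representation F G n) B :
  intertwines rW rV B -> mxmodule rV <<B>>%MS.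
Proof.
move=> hB; apply/mxmoduleP => x Gx.
by rewrite (eqmxMr _ (genmxE B)) genmxE -hB // submxMl.
Qed.

Lemma intertwines_rsim m (rW : mx_representation F G m)
    n (rV : mx_representation F G n) B (U : 'M_n) (modU : mxmodule rV U) :
  row_free B -> intertwines rW rV B -> (U :=: B)%MS ->
  mx_rsim rW (submod_repr modU).
Proof.
move=> freeB hB eUB; have sBU : (B <= U)%MS by rewrite eUB.
exists (in_submod U B).
- by rewrite eUB; move/eqP: freeB.
(* Followed by the inclusion of [U], the corestriction gives back [B], so its rank is at least that
   of [B]. *)
- rewrite -row_leq_rank; apply: leq_trans (mxrankM_maxl _ (val_submod 1%:M)).
  by rewrite -val_submodE in_submodK // row_leq_rank.
by move=> x Gx; rewrite -in_submodJ // -hB // in_submodE [RHS]in_submodE mulmxA.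
Qed.

(** One injective matrix replaces a submodule with an isomorphism onto it, so embeddings compose by
    multiplication. *)
Lemma iso_submoduleP m (rW : mx_representation F G m)
    n (rV : mx_representation F G n) :
  iso_submodule rW rV <-> exists2 B, row_free B & intertwines rW rV B.
Proof.
split=> [[U [modU [B _ freeB hB]]] | [B freeB hB]].
  exists (B *m val_submod 1%:M).
    by apply: row_free_mul => //; apply: val_submod1_free.
  exact: intertwines_mul hB (val_submod_intertwines modU).
exists <<B>>%MS, (intertwines_module hB).
by apply: intertwines_rsim freeB hB (genmxE B).
Qed.

Lemma iso_submodule_trans m (rW : mx_representation F G m)
    n (rV : mx_representation F G n) p (rU : mx_representation F G p) :
  iso_submodule rW rV -> iso_submodule rV rU -> iso_submodule rW rU.
Proof.
move=> /iso_submoduleP[B fB hB] /iso_submoduleP[C fC hC].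
apply/iso_submoduleP; exists (B *m C); first exact: row_free_mul.
exact: intertwines_mul hB hC.
Qed.

Lemma rsim_iso_submodule m (rW : mx_representation F G m)
    n (rV : mx_representation F G n) :
  mx_rsim rW rV -> iso_submodule rW rV.
Proof. by case=> B _ fB hB; apply/iso_submoduleP; exists B. Qed.

Lemma iso_submodule_rsim m (rW : mx_representation F G m)
    n (rV : mx_representation F G n) :
  iso_submodule rW rV -> m = n -> mx_rsim rW rV.
Proof. by case/iso_submoduleP=> B fB hB eq_mn; exists B. Qed.

Lemma irr_submodule_exists n (rV : mx_representation F G n) :
  (0 < n)%N ->
  exists2 W : representation F G, mx_irreducible W & iso_submodule W rV.
Proof.
move=> n_gt0; have nz1 : (1%:M : 'M[F]_n) != 0.
  by rewrite -mxrank_eq0 mxrank1 -lt0n.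
apply: (classically_Prop (mxsimple_exists (mxmodule1 rV) nz1)) => -[U simU _].
have modU := mxsimple_module simU.
exists (Representation (submod_repr modU)); first exact/submod_mx_irr.
by exists U, modU; apply: mx_rsim_refl.
Qed.

End Intertwiners.

Lemma iso_submodule_subg (F : fieldType) (gT : finGroupType)
    (G N : {group gT}) (sNG : N \subset G) m (rW : mx_representation F G m)
    n (rV : mx_representation F G n) :
  iso_submodule rW rV -> iso_submodule (subg_repr rW sNG) (subg_repr rV sNG).
Proof.
case/iso_submoduleP=> B fB hB; apply/iso_submoduleP; exists B => // x Nx.
by apply: hB; apply: (fintype.subsetP sNG).
Qed.

(** * Conjugate modules *)

Section Conjugation.

Variables (F : fieldType) (gT : finGroupType) (G N : {group gT}).
Variable nNG : N <| G.
Let sNG := normal_sub nNG.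

Lemma conj_modE n (rW : mx_representation F N n) g (Gg : g \in G) x :
  conj_mod nNG rW Gg x = rW (g * x * g^-1)%g.
Proof. by []. Qed.

Lemma memJ_normal_inv g x : g \in G -> (g * x * g^-1 \in N)%g = (x \in N).
Proof.
move=> Gg; rewrite -mulgA -{1}(invgK g) -conjgE memJ_norm ?groupV //.
exact: (fintype.subsetP (normal_norm nNG)).
Qed.

Lemma conj_intertwines m (rW : mx_representation F N m)
    n (rV : mx_representation F N n) g (Gg : g \in G) B :
  intertwines rW rV B ->
  intertwines (conj_mod nNG rW Gg) (conj_mod nNG rV Gg) B.
Proof. by move=> hB x Nx; rewrite !conj_modE hB ?memJ_normal_inv. Qed.

Lemma conj_iso_submodule m (rW : mx_representation F N m)
    n (rV : mx_representation F N n) g (Gg : g \in G) :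
  iso_submodule rW rV ->
  iso_submodule (conj_mod nNG rW Gg) (conj_mod nNG rV Gg).
Proof.
case/iso_submoduleP=> B fB hB; apply/iso_submoduleP.
by exists B => //; apply: conj_intertwines.
Qed.

Lemma conj_rsim m (rW : mx_representation F N m)
    n (rV : mx_representation F N n) g (Gg : g \in G) :
  mx_rsim rW rV -> mx_rsim (conj_mod nNG rW Gg) (conj_mod nNG rV Gg).
Proof. by case=> B e fB hB; exists B => //; apply: conj_intertwines. Qed.

Lemma eq_rsim n (rW rW' : mx_representation F N n) :
  (forall x, x \in N -> rW x = rW' x) -> mx_rsim rW rW'.
Proof.
move=> eW; exists 1%:M => //; first by rewrite /row_free mxrank1.
by move=> x Nx; rewrite mulmx1 mul1mx eW.
Qed.

Lemma conj_modM n (rW : mx_representation F N n) g h (Gg : g \in G)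
    (Gh : h \in G) (Ggh : (g * h)%g \in G) :
  mx_rsim (conj_mod nNG (conj_mod nNG rW Gg) Gh) (conj_mod nNG rW Ggh).
Proof.
by apply: eq_rsim => x Nx; rewrite !conj_modE invMg !mulgA.
Qed.

Lemma conj_mod1 n (rW : mx_representation F N n) (G1 : 1%g \in G) :
  mx_rsim (conj_mod nNG rW G1) rW.
Proof. by apply: eq_rsim => x Nx; rewrite conj_modE mul1g invg1 mulg1. Qed.

(** [N] acts on the conjugate through the same set of matrices, so the submodules are the same. *)
Lemma conj_irr n (rW : mx_representation F N n) g (Gg : g \in G) :
  mx_irreducible rW -> mx_irreducible (conj_mod nNG rW Gg).
Proof.
move=> [_ nz1 minW]; split=> //; first exact: mxmodule1.
move=> U modU; apply: minW; apply/mxmoduleP => x Nx.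
have := mxmoduleP modU (g^-1 * x * g)%g.
rewrite conj_modE !mulgA mulgV mul1g mulgK; apply.
by have := memJ_normal_inv x (groupVr Gg); rewrite invgK => ->.
Qed.

Lemma same_G_orbit_rsim (W W' : representation F N) :
  mx_rsim W W' -> same_G_orbit nNG W W'.
Proof.
move=> sWW'; exists 1%g, (group1 G); apply: mx_rsim_trans sWW'.
exact: conj_mod1.
Qed.

Lemma same_G_orbit_trans (W1 W2 W3 : representation F N) :
  same_G_orbit nNG W1 W2 -> same_G_orbit nNG W2 W3 -> same_G_orbit nNG W1 W3.
Proof.
case=> g [Gg s12] [h [Gh s23]]; exists (g * h)%g, (groupM Gg Gh).
apply: mx_rsim_trans s23; apply: mx_rsim_trans (conj_rsim Gh s12).
by apply: mx_rsim_sym; apply: conj_modM.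
Qed.

Lemma G_invariant_rsim m (rW : mx_representation F N m)
    n (rV : mx_representation F N n) :
  mx_rsim rW rV -> G_invariant nNG rW -> G_invariant nNG rV.
Proof.
move=> sWV invW g Gg; apply: mx_rsim_trans (sWV).
by apply: mx_rsim_trans (invW g Gg); apply: conj_rsim; apply: mx_rsim_sym.
Qed.

(** The isomorphism is the action of [g] itself, because [(g x g^-1) g = g x]. *)
Lemma G_invariant_subg n (rV : mx_representation F G n) :
  G_invariant nNG (subg_repr rV sNG).
Proof.
move=> g Gg; exists (rV g) => //; first exact: repr_mx_free.
move=> x Nx; have Gx : x \in G by apply: (fintype.subsetP sNG).
by rewrite conj_modE /= -!repr_mxM ?groupM ?groupV // mulgKV.
Qed.

Lemma G_invariant_orbit_submodule (W W' : representation F N)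
    n (rV : mx_representation F N n) :
  G_invariant nNG rV -> same_G_orbit nNG W W' ->
  iso_submodule W rV -> iso_submodule W' rV.
Proof.
move=> invV [g [Gg sWW']] isoW.
apply: iso_submodule_trans (rsim_iso_submodule (mx_rsim_sym sWW')) _.
apply: iso_submodule_trans (conj_iso_submodule Gg isoW) _.
exact: rsim_iso_submodule (invV g Gg).
Qed.

(** By Clifford, the restriction of [rV] is the sum of translates of the image of [W]. A simple
    submodule isomorphic to [W'] is then isomorphic to one translate, say by [x], and that translate
    is a copy of [W^x]. *)
Lemma Clifford_same_G_orbit n (rV : mx_representation F G n)
    (W W' : representation F N) :
  mx_irreducible rV -> mx_irreducible W -> mx_irreducible W' ->
  iso_submodule W (subg_repr rV sNG) -> iso_submodule W' (subg_repr rV sNG) ->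
  same_G_orbit nNG W W'.
Proof.
move=> irrV irrW irrW' /iso_submoduleP[B fB hB] [U' [modU' sW'U']].
have modU := intertwines_module hB.
have sWU := intertwines_rsim modU fB hB (genmxE B).
have simU : mxsimple (subg_repr rV sNG) <<B>>%MS.
  by apply/(submod_mx_irr modU); apply: mx_rsim_irr irrW.
have simU' : mxsimple (subg_repr rV sNG) U'.
  by apply/(submod_mx_irr modU'); apply: mx_rsim_irr irrW'.
have [X sXG [defX _]] := Clifford_basis irrV simU.
have := submx1 U'; rewrite -defX -[(\sum_(x in X) _)%MS]mulmx1.
case/(hom_mxsemisimple_iso simU') => [x Xx _ | | x Xx isoUU'].
- by apply: Clifford_simple; rewrite // (fintype.subsetP sXG).
- exact: scalar_mx_hom.
have Gx := fintype.subsetP sXG x Xx; exists x, Gx.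
have modUx : mxmodule (subg_repr rV sNG) (<<B>>%MS *m rV x).
  exact/mxsimple_module/Clifford_simple.
apply: mx_rsim_trans (mx_rsim_sym sW'U').
apply: (mx_rsim_trans (rG2 := submod_repr modUx)); last exact/mx_rsim_iso.
(* Embedding by [B] and then acting by [x] is a homomorphism on [W^x], with the translate as its
   image. *)
apply: (@intertwines_rsim _ _ _ _ _ _ _ (B *m rV x)).
- by apply: row_free_mul => //; apply: repr_mx_free.
- move=> y Ny; rewrite conj_modE mulmxA hB ?memJ_normal_inv //= -!mulmxA.
  have Gy : y \in G by apply: (fintype.subsetP sNG).
  by rewrite -!repr_mxM ?groupM ?groupV // mulgKV.
exact/eqmxMr/genmxE.
Qed.

End Conjugation.

(** * Central idempotents of the group algebra *)

Section GroupRing.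

Variables (F : fieldType) (gT : finGroupType) (G : {group gT}).

Lemma intertwines_gring_op m (rW : mx_representation F G m)
    n (rV : mx_representation F G n) B A :
  intertwines rW rV B -> (A \in group_ring F G)%MS ->
  gring_op rW A *m B = B *m gring_op rV A.
Proof.
move=> hB /envelop_mxP[a ->].
have opE p (r : mx_representation F G p) :
    gring_op r (\sum_(x in G) a x *: regular_repr F G x)
      = \sum_(x in G) a x *: r x.
  by rewrite linear_sum; apply: eq_bigr => x Gx; rewrite linearZ /= gring_opG.
by rewrite !opE; apply: intertwines_sum.
Qed.

Hypothesis F'G : [pchar F]^'.-group G.
Variable sG : irrType F G.

Lemma Wedderburn_id_gring (M : sG) : (Wedderburn_id M \in group_ring F G)%MS.
Proof.
apply: submx_trans (Wedderburn_id_mem M) _.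
by rewrite -(Wedderburn_sum_pchar sG F'G) (sumsmx_sup M).
Qed.

(** The center of a direct sum of ideals is the sum of their centers, and an identity element is
    central in its ideal. *)
Lemma Wedderburn_id_central (M : sG) : (Wedderburn_id M \in 'Z(group_ring F G))%MS.
Proof.
rewrite (mxdirect_sums_center (Wedderburn_sum_pchar sG F'G)
  (Wedderburn_direct sG) (@Wedderburn_ideal _ _ _ sG)).
rewrite (sumsmx_sup M) //; apply/center_mxP.
have [_ eM idl idr] := Wedderburn_is_id_pchar F'G M.
by split=> // A MA; rewrite idl ?idr.
Qed.

Lemma Wedderburn_idC (M : sG) A :
  (A \in group_ring F G)%MS -> A *m Wedderburn_id M = Wedderburn_id M *m A.
Proof. by move=> GA; have /center_mxP[_ ->] := Wedderburn_id_central M. Qed.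

(** Rows in the component [M'] encode elements of its Wedderburn subring, which the identities of
    the other subrings annihilate. *)
Lemma component_mul_id (M M' : sG) m (U : 'M_(m, #|G|)) :
  (U <= M')%MS -> U *m Wedderburn_id M = if M' == M then U else 0.
Proof.
move=> sUM'; apply/row_matrixP => i; rewrite row_mul.
have sbM' : (row i U <= M')%MS by apply: submx_trans (row_sub i U) _.
have RM'b : (gring_mx (regular_repr F G) (row i U) \in (Wedderburn_subring M'))%MS.
  by rewrite genmxE mem_gring_mx.
rewrite -[row i U in LHS]gring_mxK -gring_row_mul.
case: eqP => [eM | /eqP neM].
  have [_ _ _ idr] := Wedderburn_is_id_pchar F'G M.
  by rewrite idr ?gring_mxK // -eM.
rewrite (Wedderburn_mulmx0 neM RM'b (Wedderburn_id_mem M)).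
by rewrite linear0 row0.
Qed.

Lemma mul_Wedderburn_id_sub (M : sG) m (U : 'M_(m, #|G|)) :
  (U *m Wedderburn_id M <= M)%MS.
Proof.
apply/row_subP => i; rewrite row_mul -[row i U]gring_mxK -gring_row_mul.
have /andP[idl _] := Wedderburn_ideal M.
have := mulsmx_subP idl (gring_mx _ (row i U)) (Wedderburn_id M) (gring_mxP _ _)
  (Wedderburn_id_mem M).
by rewrite genmxE mem_sub_gring => /andP[].
Qed.

Lemma gring_op_Wedderburn_id n (rV : mx_representation F G n) (M : sG) :
  mx_irreducible rV -> gring_op rV (Wedderburn_id M) = (irr_comp sG rV == M)%:R%:M.
Proof.
move=> irrV; case: eqP => [<- | /eqP neM]; last first.
  rewrite (irr_comp'_op0_pchar F'G irrV _ (Wedderburn_id_mem M)).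
    by rewrite -scalemx1 mulr0n scale0r.
  by rewrite eq_sym.
have [B eB fB hB] := rsim_irr_comp_pchar sG F'G irrV.
apply/(row_free_inj fB); rewrite (intertwines_gring_op hB) ?Wedderburn_id_gring //.
by rewrite op_Wedderburn_id_pchar // mulmx1 mul1mx.
Qed.

(** [socle_base M] is a single simple module of type [M], so this sum contains each type in [O] with
    multiplicity one. *)
Lemma sum_socle_base_module (O : {set sG}) :
  mxmodule (regular_repr F G) (\sum_(M in O) socle_base M)%MS.
Proof. by apply: sumsmx_module => M _; apply: socle_module. Qed.

(* Injectivity: the idempotent [Wedderburn_id M], acting on [rV], isolates the component
   of the embedding that is carried by the summand [socle_base M]. *)
Lemma sum_socle_base_iso_submodule (O : {set sG})
    n (rV : mx_representation F G n) :
  (forall M, M \in O -> iso_submodule (irr_repr M) rV) ->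
  iso_submodule (submod_repr (sum_socle_base_module O)) rV.
Proof.
move=> isoO; set S := (\sum_(M in O) socle_base M)%MS.
pose goodC (M : sG) C := M \in O -> row_free C /\ intertwines (irr_repr M) rV C.
(* Outside [O] the condition is vacuous and [C M] is set to 0, so that one family is indexed by all
   of [sG]. *)
have [C CP] : exists C, forall M, goodC M (C M).
  apply: fin_all_exists => M; case: (boolP (M \in O)) => [OM | notOM].
    by have /iso_submoduleP[C fC hC] := isoO M OM; exists C.
  by exists 0 => /(negP notOM).
have SeM M m (U : 'M_(m, #|G|)) : (U <= S)%MS ->
    (U *m Wedderburn_id M <= if M \in O then socle_base M else 0)%MS.
  move=> sUS; apply: submx_trans (submxMr _ sUS) _.
  rewrite sumsmxMr; apply/sumsmx_subP => M' OM'.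
  rewrite (component_mul_id M (component_mx_id (socle_simple M'))).
  by case: eqP => [<- | _]; rewrite ?OM' ?sub0mx.
(* [phi] projects to each summand, takes coordinates there and applies the given embedding of that
   summand. *)
pose phi := \sum_(M in O) (Wedderburn_id M) *m in_submod (socle_base M) 1%:M *m C M.
have phiE m (U : 'M_(m, #|G|)) :
    U *m phi = \sum_(M in O) in_submod (socle_base M) (U *m Wedderburn_id M) *m C M.
  rewrite mulmx_sumr; apply: eq_bigr => M OM.
  by rewrite [in_submod _ (U *m _)]in_submodE !mulmxA.
apply/iso_submoduleP; exists (val_submod 1%:M *m phi).
  apply: inj_row_free => v; rewrite mulmxA -val_submodE phiE.
  set u := val_submod v => u0.
  have sub_uS : (u <= S)%MS by apply: val_submodP.
  suff : u == 0 by rewrite val_submod_eq0 => /eqP.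
  rewrite -[u]mulmx1 -(Wedderburn_sum_id_pchar sG F'G) mulmx_sumr big1 // => M _.
  apply/eqP; rewrite -submx0; have := SeM M _ _ sub_uS; case: ifP => // OM sub_ueM.
  have [fC hC] := CP M OM.
  suff : in_submod (socle_base M) (u *m Wedderburn_id M) *m C M == 0.
    rewrite -(mul0mx _ (C M)) => /eqP/(row_free_inj fC) u0M.
    by rewrite -(in_submodK sub_ueM) u0M linear0 sub0mx.
  have := congr1 (mulmx^~ (gring_op rV (Wedderburn_id M))) u0.
  rewrite /= mul0mx mulmx_suml (bigD1 M) //= big1 => [|M' /andP[OM' neM]].
    rewrite addr0 -mulmxA -(intertwines_gring_op hC) ?Wedderburn_id_gring //.
    by rewrite op_Wedderburn_id_pchar // mul1mx => ->.
  have [_ hC'] := CP M' OM'.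
  rewrite -mulmxA -(intertwines_gring_op hC') ?Wedderburn_id_gring //.
  rewrite (irr_repr'_op0_pchar F'G _ (Wedderburn_id_mem M)) 1?eq_sym //.
  by rewrite mul0mx mulmx0.
move=> x Gx; rewrite mulmxA (val_submod_intertwines _ Gx).
rewrite !phiE mulmx_suml; apply: eq_bigr => M OM.
have [_ hC] := CP M OM.
have sub1S : (val_submod (1%:M : 'M_(\rank S)) <= S)%MS by apply: val_submodP.
rewrite -[_ *m Wedderburn_id M]mulmxA (Wedderburn_idC M (envelop_mx_id _ Gx)) mulmxA.
rewrite (in_submodJ (socle_module M)); last by have := SeM M _ _ sub1S; rewrite OM.
by rewrite -[LHS]mulmxA -[RHS]mulmxA; congr (_ *m _); apply: hC.
Qed.

End GroupRing.

(** * Minimal invariant modules *)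

Section MinimalInvariant.

Variables (F : fieldType) (gT : finGroupType) (G N : {group gT}).
Variable nNG : N <| G.

(** A nonzero invariant submodule of least dimension is minimal. *)
Lemma minimal_G_invariant_exists n (rV : mx_representation F N n) :
  (0 < n)%N -> G_invariant nNG rV ->
  exists2 W, minimal_G_invariant nNG W & iso_submodule W rV.
Proof.
move=> n_gt0 invV.
pose inv_rank r := `[< [/\ (0 < r)%N & exists (U : 'M_n)
  (modU : mxmodule rV U), \rank U = r /\ G_invariant nNG (submod_repr modU)] >].
have ex_r : exists r, inv_rank r.
  exists n; apply/asboolP; split=> //; exists 1%:M, (mxmodule1 rV).
  split; first exact: mxrank1.
  apply: G_invariant_rsim invV; apply: mx_rsim_sym.
  exact: rsim_submod1 (eqmx_refl _).
case: (ex_minnP ex_r) => r /asboolP[r_gt0 [U [modU [rU invU]]]] min_r.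
exists (Representation (submod_repr modU)); last first.
  by exists U, modU; apply: mx_rsim_refl.
split=> //=; first by rewrite /nonzero_mod /= rU.
move=> U' modU' nzU' invU'; rewrite sub1mx -col_leq_rank.
(* Leastness concerns submodules of [rV], so the submodule [U'] of the chosen module is first
   carried over to one of [rV]. *)
have isoU' : iso_submodule (submod_repr modU') rV.
  apply: (@iso_submodule_trans _ _ _ _ _ _ (submod_repr modU)).
    by exists U', modU'; apply: mx_rsim_refl.
  by exists U, modU; apply: mx_rsim_refl.
have [U2 [modU2 sU'2]] := isoU'.
rewrite {1}rU; apply: min_r; apply/asboolP.
split; first by rewrite lt0n mxrank_eq0.
exists U2, modU2; split; first by rewrite -(mxrank_rsim sU'2).
exact: G_invariant_rsim sU'2 invU'.
Qed.

(** The image of the embedding is a nonzero invariant submodule of [W], hence all of [W]. *)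
Lemma minimal_G_invariant_rsim_sub (W : representation F N)
    n (rV : mx_representation F N n) :
  minimal_G_invariant nNG W -> (0 < n)%N -> G_invariant nNG rV ->
  iso_submodule rV W -> mx_rsim rV W.
Proof.
case=> _ _ minW n_gt0 invV isoVW; apply: iso_submodule_rsim (isoVW) _.
have [U [modU sVU]] := isoVW; rewrite (mxrank_rsim sVU).
have nzU : U != 0 by rewrite -mxrank_eq0 -(mxrank_rsim sVU) -lt0n.
have := minW U modU nzU (G_invariant_rsim sVU invV).
by rewrite sub1mx => /eqP.
Qed.

Hypothesis F'N : [pchar F]^'.-group N.

Section OrbitSum.

Variables (sN : irrType F N) (W : representation F N).
Hypothesis irrW : mx_irreducible W.

(** The orbit of [W], as a set of types; [S] is then the sum of one copy of each conjugate of
    [W]. *)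
Let O := [set M : sN | `[< same_G_orbit nNG W (Representation (irr_repr M)) >]].
Let S := submod_repr (sum_socle_base_module O).

Lemma mem_orbit_set (W' : representation F N) :
  mx_irreducible W' -> same_G_orbit nNG W W' ->
  exists2 M : sN, M \in O & mx_rsim W' (irr_repr M).
Proof.
move=> irrW' sWW'; have sW'M := rsim_irr_comp_pchar sN F'N irrW'.
exists (irr_comp sN W') => //; rewrite inE; apply/asboolP.
apply: same_G_orbit_trans sWW' _.
exact: (@same_G_orbit_rsim _ _ _ _ nNG W' (Representation _)).
Qed.

Lemma irr_repr_orbit_sum M : M \in O -> iso_submodule (irr_repr M) S.
Proof.
move=> OM.
have sMO : (socle_base M <= \sum_(M in O) socle_base M)%MS by apply: sumsmx_sup OM _.
have [modM sM] := mx_rsim_in_submod (socle_module M)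
  (sum_socle_base_module O) sMO.
by exists (<<in_submod (\sum_(M in O) socle_base M)%MS (socle_base M)>>)%MS, modM.
Qed.

Lemma orbit_sum_gt0 : (0 < \rank (\sum_(M in O) socle_base M)%MS)%N.
Proof.
have [M OM _] := mem_orbit_set irrW (same_G_orbit_rsim nNG (mx_rsim_refl W)).
apply: leq_trans (irr_degree_gt0 M) _.
by apply: mxrankS; apply: sumsmx_sup OM _.
Qed.

(** The dimensions agree, so it suffices to embed [S] in [S^g], one type at a time. The conjugate of
    [M] by [g^-1] lies in the orbit and so embeds in [S]; conjugating by [g] embeds [M] in [S^g]. *)
Lemma orbit_sum_invariant : G_invariant nNG S.
Proof.
move=> g Gg; apply: mx_rsim_sym; apply: iso_submodule_rsim => //.
apply: sum_socle_base_iso_submodule => // M; rewrite inE => /asboolP oWM.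
have Gg' := groupVr Gg.
pose W1 := Representation (conj_mod nNG (irr_repr M) Gg').
have irrM : mx_irreducible (irr_repr M) by apply: socle_irr.
have [|M1 OM1 sM1] := @mem_orbit_set W1 (conj_irr nNG Gg' irrM).
  apply: same_G_orbit_trans oWM _.
  by exists g^-1%g, Gg'; apply: mx_rsim_refl.
have Gg'g : (g^-1 * g)%g \in G by rewrite mulVg.
apply: iso_submodule_trans (conj_iso_submodule nNG Gg (irr_repr_orbit_sum OM1)).
apply: rsim_iso_submodule; apply: mx_rsim_trans (conj_rsim nNG Gg sM1).
apply: mx_rsim_sym; apply: mx_rsim_trans (conj_modM nNG _ Gg' Gg Gg'g) _.
by apply: eq_rsim => x Nx; rewrite conj_modE mulVg mul1g invg1 mulg1.
Qed.

(** Being invariant, [A] contains every conjugate of [W], hence a copy of the invariant module [S];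
    minimality makes this copy all of [A]. *)
Lemma minimal_G_invariant_orbit_sum (A : representation F N) :
  minimal_G_invariant nNG A -> iso_submodule W A -> mx_rsim S A.
Proof.
move=> minA isoWA; have [_ invA _] := minA.
apply: minimal_G_invariant_rsim_sub => //; first exact: orbit_sum_gt0.
  exact: orbit_sum_invariant.
apply: sum_socle_base_iso_submodule => // M; rewrite inE => /asboolP oWM.
exact: (@G_invariant_orbit_submodule _ _ _ _ nNG W (Representation _)) isoWA.
Qed.

End OrbitSum.

Lemma minimal_G_invariant_rsim (W A B : representation F N) :
  mx_irreducible W -> minimal_G_invariant nNG A -> minimal_G_invariant nNG B ->
  iso_submodule W A -> iso_submodule W B -> mx_rsim A B.
Proof.
move=> irrW minA minB isoWA isoWB.
apply: (classically_Prop (socle_exists (regular_repr F N))) => sN.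
apply: mx_rsim_trans (minimal_G_invariant_orbit_sum sN irrW minB isoWB).
exact/mx_rsim_sym/minimal_G_invariant_orbit_sum.
Qed.

End MinimalInvariant.

(** * The subalgebra of a normal subgroup and the block idempotents *)

Section RestrictionOfRegular.

Variables (F : fieldType) (gT : finGroupType) (G N : {group gT}).
Hypothesis sNG : N \subset G.

Let aN := regular_repr F N.
Let aG := regular_repr F G.
Let aGN := subg_repr aG sNG.
Let KN := subgroup_ring F sNG.

Lemma subgroup_ring_sub : (KN <= group_ring F G)%MS.
Proof.
apply/memmx_subP => _ /envelop_mxP[a ->]; rewrite linear_sum summx_sub // => x Nx.
by rewrite linearZ scalemx_sub // envelop_mx_id // (fintype.subsetP sNG).
Qed.

(** The inclusion of K[N] in K[G], in the coordinates of the two regular modules. *)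
Definition regular_incl : 'M[F]_(#|N|, #|G|) :=
  \matrix_(i < #|N|) gring_row (aG (enum_val i)).

Lemma regular_incl_intertwines : intertwines aN aGN regular_incl.
Proof.
move=> x Nx; apply/row_matrixP => i.
rewrite row_mul rowK -rowE row_mul !rowK gring_indexK ?groupM ?enum_valP //.
by rewrite repr_mxM ?gring_row_mul // (fintype.subsetP sNG) ?enum_valP.
Qed.

Lemma gring_row_regular x : x \in G -> gring_row (aG x) = delta_mx 0 (gring_index G x).
Proof. by move=> Gx; rewrite /gring_row rowK gring_indexK // mul1g. Qed.

Lemma regular_incl_free : row_free regular_incl.
Proof.
apply/row_freeP.
exists (\matrix_(g < #|G|, i < #|N|) (enum_val g == enum_val i)%:R).
have GN (i : 'I_#|N|) : enum_val i \in G.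
  by rewrite (fintype.subsetP sNG) ?enum_valP.
apply/row_matrixP => i; rewrite row_mul rowK gring_row_regular // -rowE.
apply/rowP => j; rewrite !mxE gring_indexK //.
by rewrite (inj_eq enum_val_inj).
Qed.

Lemma gring_mx_regular_incl v : (gring_mx aG (v *m regular_incl) \in KN)%MS.
Proof.
rewrite mulmx_sum_row (linear_sum (gring_mx aG)) (linear_sum mxvec).
rewrite summx_sub // => i _.
rewrite 2!linearZ scalemx_sub // rowK /= gring_rowK.
  exact/(envelop_mx_id aGN)/enum_valP.
by apply/envelop_mx_id/(fintype.subsetP sNG)/enum_valP.
Qed.

(** The coefficients [a] let [A] act on K[N]-modules. They are the same for all modules, which
    allows the actions of [A] on different K[G]-modules to be compared on a common
    K[N]-submodule. *)
Lemma gring_op_subgroup_ring A : (A \in KN)%MS ->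
  exists a, forall n (rV : mx_representation F G n)
    m (rW : mx_representation F N m) B,
  intertwines rW (subg_repr rV sNG) B ->
  (\sum_(x in N) a x *: rW x) *m B = B *m gring_op rV A.
Proof.
move=> /envelop_mxP[a ->]; exists a => n rV m rW B /intertwines_sum ->.
congr (_ *m _); rewrite linear_sum; apply: eq_bigr => x Nx.
by rewrite linearZ /= gring_opG // (fintype.subsetP sNG).
Qed.

Hypothesis F'G : [pchar F]^'.-group G.
Variable sG : irrType F G.

Lemma Wedderburn_id_intertwines (M : sG) : intertwines aGN aGN (Wedderburn_id M).
Proof.
move=> x Nx; apply: Wedderburn_idC => //.
exact/envelop_mx_id/(fintype.subsetP sNG).
Qed.

(* Any vector [v] of [rV] gives a homomorphism [a |-> v a] from F[G] to [rV];
   the component of [rV] acts faithfully on [rV], so that [v] can be chosen with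
   nonzero values on the image of [B]. *)
Lemma regular_intertwines_iso_submodule m (rW : mx_representation F N m)
    n (rV : mx_representation F G n) B :
  mx_irreducible rW -> mx_irreducible rV -> intertwines rW aGN B ->
  B *m Wedderburn_id (irr_comp sG rV) != 0 ->
  iso_submodule rW (subg_repr rV sNG).
Proof.
move=> irrW irrV hB; set B' := B *m _ => nzB'.
have hB' : intertwines rW aGN B'.
  exact: intertwines_mul hB (Wedderburn_id_intertwines _).
have /rowV0Pn[_ /submxP[u ->] nz_r] := nzB'.
set r := u *m B' in nz_r.
have Ry : (gring_mx aG r \in Wedderburn_subring (irr_comp sG rV))%MS.
  by rewrite genmxE mem_gring_mx /r mulmxA mul_Wedderburn_id_sub.
have nzVr : gring_mx rV r != 0.
  apply: contra nz_r; rewrite -gring_op_mx -(linear0 (gring_op rV)) => /eqP eq0.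
  rewrite -[r]gring_mxK.
  have R0 : (0 \in Wedderburn_subring (irr_comp sG rV))%MS by rewrite linear0 sub0mx.
  by rewrite (regular_op_inj_pchar F'G irrV Ry R0 eq0) linear0.
have /rowV0Pn[_ /submxP[v ->] nz_vr] := nzVr.
pose phi := lin1_mx (mulmx v \o gring_mx rV).
have phiE w : w *m phi = v *m gring_mx rV w by rewrite mul_rV_lin1.
have hphi : intertwines aG rV phi.
  move=> x Gx; apply/row_matrixP => i.
  by rewrite !row_mul phiE !rowE phiE gring_mxJ // mulmxA.
have nzC : B' *m phi != 0.
  by apply: contra nz_vr => /eqP C0; rewrite -phiE /r -mulmxA C0 mulmx0.
have hC : intertwines rW (subg_repr rV sNG) (B' *m phi).
  apply: intertwines_mul hB' _ => x Nx.
  exact/hphi/(fintype.subsetP sNG).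
by apply/iso_submoduleP; exists (B' *m phi); first exact: irr_intertwines_free hC nzC.
Qed.

(** [W] embeds in K[N], hence in K[G]; the Wedderburn identities sum to 1, so one of them does not
    kill its image. *)
Lemma irr_iso_submodule_restriction (W : representation F N) :
  mx_irreducible W -> exists M : sG, iso_submodule W (subg_repr (irr_repr M) sNG).
Proof.
move=> irrW.
have F'N : [pchar F]^'.-group N by apply: pgroupS F'G.
have [U [modU /rsim_iso_submodule isoWU]] := rsim_regular_submod_pchar irrW F'N.
have /iso_submoduleP[C fC hC] : iso_submodule W aN.
  by apply: iso_submodule_trans isoWU _; exists U, modU; apply: mx_rsim_refl.
have nzB : C *m regular_incl != 0.
  have fB := row_free_mul fC regular_incl_free.
  rewrite -mxrank_eq0 (eqP fB) -lt0n.
  by have [] := (mx_irrP W).1 irrW.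
have [M nzM] : exists M : sG, C *m regular_incl *m Wedderburn_id M != 0.
  apply/existsP; apply: contraNT nzB; rewrite negb_exists => /forallP B0.
  rewrite -[_ *m _]mulmx1 -(Wedderburn_sum_id_pchar sG F'G) mulmx_sumr.
  by rewrite big1 // => M _; apply/eqP; have := B0 M; rewrite negbK.
exists M; apply: (@regular_intertwines_iso_submodule _ _ _ _ (C *m regular_incl)) => //.
- exact: socle_irr.
- exact: intertwines_mul hC regular_incl_intertwines.
by rewrite irr_reprK_pchar.
Qed.

Section Blocks.

Variables (I : finType) (tau : sG -> I).
Hypothesis tauP : forall M M',
  equiv_wrt sNG (Representation (irr_repr M)) (Representation (irr_repr M')) <->
  tau M = tau M'.

(** The central idempotent e_i of the class [i]. *)
Definition block_id (i : I) : 'M[F]_#|G| := \sum_(M | tau M == i) Wedderburn_id M.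

Lemma sum_block_id : \sum_i block_id i = 1%:M.
Proof.
by rewrite -(Wedderburn_sum_id_pchar sG F'G) (partition_big tau xpredT).
Qed.

Lemma block_id_central i : (block_id i \in 'Z(group_ring F G))%MS.
Proof.
rewrite /block_id linear_sum summx_sub // => M _; exact: Wedderburn_id_central.
Qed.

Lemma block_idC i A :
  (A \in group_ring F G)%MS -> A *m block_id i = block_id i *m A.
Proof. by move=> GA; have /center_mxP[_ ->] := block_id_central i. Qed.

Lemma Wedderburn_subring_block_id (M : sG) i A :
  (A \in Wedderburn_subring M)%MS ->
  A *m block_id i = if tau M == i then A else 0.
Proof.
move=> RA; rewrite mulmx_sumr.
have [_ _ _ idr] := Wedderburn_is_id_pchar F'G M.
have neq0 M' : M' != M -> A *m Wedderburn_id M' = 0.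
  rewrite eq_sym => neM.
  exact: Wedderburn_mulmx0 neM RA (Wedderburn_id_mem M').
case: ifP => tM.
  by rewrite (bigD1 M) //= idr // big1 ?addr0 // => M' /andP[_ /neq0].
by rewrite big1 // => M' tM'; apply: neq0; apply: contraFneq tM => <-.
Qed.

Lemma block_id_mul i j :
  block_id i *m block_id j = if i == j then block_id i else 0.
Proof.
rewrite {1}/block_id mulmx_suml.
under eq_bigr => M /eqP tM.
  rewrite (Wedderburn_subring_block_id j (Wedderburn_id_mem M)) tM; over.
by case: eqP => // _; rewrite big1.
Qed.

(** Every [M] whose identity does not kill [B] contains [rW] in its restriction, so all such [M] are
    equivalent. If one is in class [i], all are, and e_i fixes [B]. *)
Lemma irr_intertwines_block_id m (rW : mx_representation F N m) B i :
  mx_irreducible rW -> intertwines rW aGN B ->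
  B *m block_id i = 0 \/ B *m block_id i = B.
Proof.
move=> irrW hB; case: (eqVneq (B *m block_id i) 0) => [-> | nzBi]; first by left.
have link (M : sG) : B *m Wedderburn_id M != 0 ->
    iso_submodule rW (subg_repr (irr_repr M) sNG).
  move=> nzM; apply: (@regular_intertwines_iso_submodule _ _ _ _ B) => //.
    exact: socle_irr.
  by rewrite irr_reprK_pchar.
have [M /andP[/eqP tM nzM]] :
    exists M : sG, (tau M == i) && (B *m Wedderburn_id M != 0).
  apply/existsP; apply: contraNT nzBi; rewrite negb_exists => /forallP B0.
  rewrite mulmx_sumr big1 // => M tM; apply/eqP.
  by have := B0 M; rewrite tM negbK.
right; rewrite -[RHS]mulmx1 -(Wedderburn_sum_id_pchar sG F'G) !mulmx_sumr.
rewrite [RHS](bigID (fun M => tau M == i)) /= [X in _ + X]big1 ?addr0 // => M' tM'.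
apply/eqP; apply: contraR tM' => nzM'; rewrite -tM eq_sym; apply/eqP/tauP.
by exists (Representation rW); split=> //; apply: link.
Qed.

(** By Maschke, K[N] is a sum of simple modules, each killed or fixed by e_i. Hence K[N] e_i lies in
    K[N], and in particular so does 1 e_i. *)
Lemma block_id_subgroup_ring i : (block_id i \in KN)%MS.
Proof.
have F'N : [pchar F]^'.-group N by apply: pgroupS F'G.
have GRi := submx_trans (block_id_central i) (center_mx_sub _).
have sub_incl : (regular_incl *m block_id i <= regular_incl)%MS.
  apply: (classically_Prop (mx_reducible_semisimple (mxmodule1 aN)
    (mx_Maschke_pchar aN F'N))) => -[J U W simU defW _].
  rewrite -[X in (X *m _ <= _)%MS]mul1mx -mulmxA.
  apply: submx_trans (submxMr _ (_ : (1%:M <= W)%MS)) _; first by rewrite defW.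
  rewrite /W sumsmxMr_gen; apply/sumsmx_subP => j _.
  rewrite genmxE mulmxA -(eqmxMr _ (eqmxMr _ (val_submod1 (U j)))).
  have modU := mxsimple_module (simU j).
  have irrU : mx_irreducible (submod_repr modU) by apply/submod_mx_irr.
  have hU := intertwines_mul (val_submod_intertwines modU) regular_incl_intertwines.
  by have [-> | ->] := irr_intertwines_block_id i irrU hU; rewrite ?sub0mx ?submxMl.
(* The unit of K[G] is the row of [regular_incl] indexed by the identity of [N]. *)
have row1 : gring_row (1%:M : 'M[F]_#|G|) = row (gring_index N 1%g) regular_incl.
  by rewrite rowK gring_indexK // repr_mx1.
have [v def_v] : exists v, gring_row (block_id i) = v *m regular_incl.
  apply/submxP; apply: submx_trans sub_incl.
  by rewrite -[block_id i in X in (X <= _)%MS]mul1mx gring_row_mul row1 -row_mul row_sub.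
by rewrite -[block_id i]gring_rowK // def_v gring_mx_regular_incl.
Qed.

Hypothesis splitG : group_splitting_field F G.

(** Over a splitting field [A] is a combination of Wedderburn identities, whose coefficient at [M]
    is the scalar by which [A] acts on [irr_repr M]; this scalar depends only on the class. *)
Lemma central_subgroup_block i A :
  (A \in 'Z(group_ring F G))%MS -> (A \in KN)%MS -> A *m block_id i = A ->
  exists c, A = c *: block_id i.
Proof.
move=> ZA NA Ai.
have [c def_A] : exists c : sG -> F, A = \sum_M c M *: Wedderburn_id M.
  move: ZA; rewrite (Wedderburn_center_pchar sG F'G splitG) => /submxP[D defD].
  exists (fun M => D 0 (enum_rank M)); apply: (can_inj mxvecK).
  rewrite defD mulmx_sum_row (reindex _ (onW_bij _ (@enum_rank_bij sG))) linear_sum.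
  by apply: eq_bigr => M _; rewrite rowK enum_rankK linearZ.
have scal M : gring_op (irr_repr M) A = (c M)%:M.
  have irrM : mx_irreducible (irr_repr M) by apply: socle_irr.
  rewrite def_A linear_sum (bigD1 M) //= big1 => [|M' neM].
    rewrite addr0 linearZ /= gring_op_Wedderburn_id // irr_reprK_pchar //.
    by rewrite eqxx scalemx1.
  rewrite linearZ /= gring_op_Wedderburn_id // irr_reprK_pchar //.
  by rewrite eq_sym (negPf neM) -scalemx1 scale0r scaler0.
(* On the common K[N]-submodule [W], the element [A] acts by one matrix, which must be both
   scalars. *)
have eq_c M M' : tau M = tau M' -> c M = c M'.
  move=> /tauP[W [irrW /iso_submoduleP[B fB hB] /iso_submoduleP[B' fB' hB']]].
  have [a opA] := gring_op_subgroup_ring NA.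
  have := opA _ _ _ W _ hB; have := opA _ _ _ W _ hB'.
  rewrite !scal !mul_mx_scalar -!mul_scalar_mx.
  move=> /(row_free_inj fB') -> /(row_free_inj fB).
  have [d_gt0 _] := (mx_irrP W).1 irrW.
  by move/matrixP/(_ (Ordinal d_gt0) (Ordinal d_gt0)); rewrite !mxE eqxx !mulr1n => ->.
have sum_i : A = \sum_(M | tau M == i) c M *: Wedderburn_id M.
  rewrite -{1}Ai {1}def_A mulmx_suml [RHS]big_mkcond; apply: eq_bigr => M _.
  rewrite -scalemxAl (Wedderburn_subring_block_id i (Wedderburn_id_mem M)).
  by case: ifP => // _; rewrite scaler0.
(* For an empty class both [A] and e_i are empty sums. *)
case: (pickP (fun M => tau M == i)) => [M0 /eqP tM0 | no_M].
  exists (c M0); rewrite {1}sum_i scaler_sumr; apply: eq_bigr => M /eqP tM.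
  by rewrite (eq_c M M0) // tM.
by exists 0; rewrite sum_i scale0r big_pred0.
Qed.

Section BlockIdeals.

Let KG := group_ring F G.
Variable T : I -> 'A[F]_(#|G| ^ 2, #|G|).
(** As e_i is idempotent, this says that T_i is K[G] e_i. *)
Hypothesis memT : forall i A,
  (A \in T i)%MS = (A \in KG)%MS && (A *m block_id i == A).
Let L i := (T i :&: KN)%MS.

(** An element [A] of the center of T_i commutes with every [B] in K[G]: as [A = A e_i] with e_i
    central, [A B = A (B e_i) = (B e_i) A = B A]. *)
Lemma mem_L_center i A :
  (A \in L i :&: 'Z(T i))%MS =
  [&& (A \in 'Z(KG))%MS, (A \in KN)%MS & A *m block_id i == A].
Proof.
rewrite !sub_capmx memT; case KGA: (A \in KG)%MS => //=.
case: eqP => [Ai | _]; last by rewrite !andbF.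
rewrite !andbT /= andbC; congr (_ && _); apply/cent_mxP/cent_mxP => cA B.
  move=> KGB; have KGi := submx_trans (block_id_central i) (center_mx_sub _).
  have TB : (B *m block_id i \in T i)%MS.
    by rewrite memT envelop_mxM //= -mulmxA block_id_mul eqxx.
  by apply: esym; rewrite -{1}Ai -mulmxA -block_idC // -cA // -mulmxA -block_idC // Ai.
by rewrite memT => /andP[/cA].
Qed.

(** Multiplication by e_i fixes the elements of [X i] and kills those of the other [X j]. *)
Lemma block_direct (X : I -> 'A[F]_(#|G| ^ 2, #|G|)) :
  (forall i A, (A \in X i)%MS -> A *m block_id i = A) ->
  mxdirect (\sum_i X i)%MS.
Proof.
move=> idX; apply/mxdirect_sumsP => i _; apply/eqP; rewrite -submx0.
apply/memmx_subP => A; rewrite sub_capmx => /andP[XA /memmx_sumsP[B defA XB]].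
rewrite -(idX i A XA) defA mulmx_suml big1 ?linear0 ?sub0mx // => j neji.
by rewrite -(idX j _ (XB j)) -mulmxA block_id_mul (negPf neji) mulmx0.
Qed.

(** The components of [A] are the products A e_i, which stay in K[N] because e_i lies there. *)
Lemma subgroup_ring_blocks :
  (KN :=: \sum_i L i)%MS /\ mxdirect (\sum_i L i)%MS.
Proof.
split; last first.
  by apply: block_direct => i A; rewrite sub_capmx memT => /andP[/andP[_ /eqP]].
apply/eqmxP/andP; split; last by apply/sumsmx_subP => i _; apply: capmxSr.
apply/memmx_subP => A NA; apply/memmx_sumsP; exists (fun i => A *m block_id i).
  by rewrite -mulmx_sumr sum_block_id mulmx1.
move=> i; have Ni := block_id_subgroup_ring i.
have NAi : (A *m block_id i \in KN)%MS by apply: envelop_mxM.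
rewrite sub_capmx NAi memT (submx_trans NAi subgroup_ring_sub) /=.
by rewrite andbT -mulmxA block_id_mul eqxx.
Qed.

Lemma center_subgroup_ring_blocks :
  ('Z(KG) :&: KN :=: \sum_i (L i :&: 'Z(T i)))%MS
    /\ mxdirect (\sum_i (L i :&: 'Z(T i)))%MS.
Proof.
split; last first.
  by apply: block_direct => i A; rewrite mem_L_center => /and3P[_ _ /eqP].
apply/eqmxP/andP; split; last first.
  apply/sumsmx_subP => i _; apply/memmx_subP => A.
  by rewrite mem_L_center => /and3P[ZA NA _]; rewrite [X in is_true X]sub_capmx ZA NA.
apply/memmx_subP => A; rewrite sub_capmx => /andP[ZA NA].
apply/memmx_sumsP; exists (fun i => A *m block_id i).
  by rewrite -mulmx_sumr sum_block_id mulmx1.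
move=> i; rewrite mem_L_center; apply/and3P; split; last first.
- by rewrite -mulmxA block_id_mul eqxx.
- exact: envelop_mxM NA (block_id_subgroup_ring i).
have [GA cA] := center_mxP ZA; have [Gi ci] := center_mxP (block_id_central i).
apply/center_mxP; split=> [|B GB]; first exact: envelop_mxM.
by rewrite mulmxA cA // -!mulmxA ci.
Qed.

Hypothesis tau_surj : forall i, exists M, tau M = i.

(** The space is the line through e_i, and e_i is nonzero because it fixes the identity of any [M]
    in the class, which [tau_surj] makes nonempty. *)
Lemma rank_L_center i : \rank (L i :&: 'Z(T i))%MS = 1%N.
Proof.
have eL : (L i :&: 'Z(T i) :=: mxvec (block_id i))%MS.
  apply/eqmxP/andP; split; last first.
    rewrite mem_L_center block_id_central block_id_subgroup_ring.
    by rewrite block_id_mul eqxx /=.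
  apply/memmx_subP => A; rewrite mem_L_center => /and3P[ZA NA /eqP Ai].
  by have [c ->] := central_subgroup_block ZA NA Ai; rewrite linearZ scalemx_sub.
rewrite eL; apply/eqP; rewrite eqn_leq rank_leq_row lt0n mxrank_eq0 mxvec_eq0.
have [M tM] := tau_surj i; have RM := Wedderburn_id_mem M.
have [nzM _ _ _] := Wedderburn_is_id_pchar F'G M.
apply: contra nzM => /eqP i0; have := Wedderburn_subring_block_id i RM.
by rewrite tM eqxx i0 mulmx0 => <-.
Qed.

End BlockIdeals.

End Blocks.

End RestrictionOfRegular.

(** * Splitting fields and homogeneous components in terms of the Wedderburn decomposition *)

Lemma splitting_field_group (F : fieldType) (gT : finGroupType) (G : {group gT}) :
  splitting_field F G -> group_splitting_field F G.
Proof.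
move=> splitF n rG irrG; apply: cent_mx_scalar_abs_irr => //.
(* The centralizer lies in the line of scalar matrices, so its rank is at most 1. *)
apply: leq_trans (rank_leq_row (mxvec (1%:M : 'M[F]_n))).
apply: mxrankS; apply/memmx_subP => A; rewrite memmx_cent_envelop memmx1.
exact: (splitF (Representation rG)).
Qed.

Section HomogeneousComponent.

Variables (F : fieldType) (gT : finGroupType) (G : {group gT}).
Hypothesis F'G : [pchar F]^'.-group G.
Variables (sG : irrType F G) (V : representation F G).
Hypothesis irrV : mx_irreducible V.

(** A submodule isomorphic to [V] lies in the socle component of that type; conversely the component
    is a sum of such submodules. *)
Lemma homogeneous_component_irr_comp :
  (homogeneous_component V :=: irr_comp sG V)%MS.
Proof.
set M := irr_comp sG V; rewrite /homogeneous_component.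
set P := fun U : 'M[F]_#|G| => _.
have sVM : mx_rsim V (irr_repr M) by apply: rsim_irr_comp_pchar.
have simM := socle_simple M.
apply/eqmxP/andP; split.
  apply/(mxsupP P) => U [modU sVU]; apply: mx_iso_component => //.
  apply/(mx_rsim_iso (socle_module M) modU).
  exact: mx_rsim_trans (mx_rsim_sym sVM) sVU.
have [J [W isoW defM]] := component_mx_def simM.
rewrite /socle_val /= defM; apply/sumsmx_subP => j _.
apply: (mxsupP P _).1 (submx_refl _) _ _.
have modW := mx_iso_module (isoW j) (socle_module M).
exists modW; apply: mx_rsim_trans sVM _.
exact/(mx_rsim_iso (socle_module M) modW).
Qed.

Lemma homogeneous_ideal_irr_comp :
  (homogeneous_ideal V :=: Wedderburn_subring (irr_comp sG V))%MS.
Proof.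
apply: eqmx_trans (genmxE _) _; apply: eqmx_trans (eqmx_sym (genmxE _)).
exact/eqmxMr/homogeneous_component_irr_comp.
Qed.

End HomogeneousComponent.

Lemma equiv_wrt_rsim (F : fieldType) (gT : finGroupType) (G N : {group gT})
    (sNG : N \subset G) (V V' U U' : representation F G) :
  mx_rsim V V' -> mx_rsim U U' -> equiv_wrt sNG V U -> equiv_wrt sNG V' U'.
Proof.
move=> sV sU [W [irrW isoWV isoWU]]; exists W; split=> //.
  exact: iso_submodule_trans isoWV (iso_submodule_subg _ (rsim_iso_submodule sV)).
exact: iso_submodule_trans isoWU (iso_submodule_subg _ (rsim_iso_submodule sU)).
Qed.

(** * The decomposition theorem and the count of classes, orbits and minimal invariant modules *)

Theorem theorem3p3 (F : fieldType) (gT : finGroupType) (G N : {group gT})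
  (nNG : (N <| G)%g)
  (splitF : splitting_field F G)
  (charF : forall p : nat, p \in [pchar F] -> ~~ (p %| #|G|)%N)
  (k : nat) (s : 'I_k -> nat)
  (V : forall i : 'I_k, 'I_(s i) -> representation F G)
  (s_gt0 : forall i, (0 < s i)%N)
  (irrV : forall i (j : 'I_(s i)), mx_irreducible (V i j))
  (nonisoV : forall i (j j' : 'I_(s i)), mx_rsim (V i j) (V i j') -> j = j')
  (classV : forall i (j : 'I_(s i)) i' (j' : 'I_(s i')),
     equiv_wrt (normal_sub nNG) (V i j) (V i' j') <-> i = i')
  (completeV : forall U : representation F G, mx_irreducible U ->
     exists i (j : 'I_(s i)), mx_rsim U (V i j)) :
  let KG := group_ring F G in
  let KN := subgroup_ring F (normal_sub nNG) in
  let T i := (\sum_(j < s i) homogeneous_ideal (V i j))%MS in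
  let L i := (T i :&: KN)%MS in
  [/\ (* (a) *)
      (KN :=: \sum_(i < k) L i)%MS /\ mxdirect (\sum_(i < k) L i)%MS,
      (* (b) *)
      ('Z(KG) :&: KN :=: \sum_(i < k) (L i :&: 'Z(T i)))%MS
        /\ mxdirect (\sum_(i < k) (L i :&: 'Z(T i)))%MS,
      (* (c) *)
      forall i : 'I_k, \rank (L i :&: 'Z(T i))%MS = 1%N
    & (* (d) *)
      [/\ \rank ('Z(KG) :&: KN)%MS = k,
          number_of_classes (minimal_G_invariant nNG)
            (fun W W' : representation F N => mx_rsim W W') k
        & number_of_classes (fun W : representation F N => mx_irreducible W)
            (same_G_orbit nNG) k]].
Proof.
move=> KG KN T L; pose sNG := normal_sub nNG.
have F'G : [pchar F]^'.-group G.
  by apply/pgroupP => p p_pr p_dvd; rewrite inE /=; apply/negP => /charF; rewrite p_dvd.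
have F'N : [pchar F]^'.-group N by apply: pgroupS F'G.
have splitG := splitting_field_group splitF.
pose j0 i := Ordinal (s_gt0 i).
apply: (classically_Prop (socle_exists (regular_repr F G))) => sG.
(* [tau] gives the class of each simple type, as found by [completeV]. *)
have [tau tauV] : exists tau : sG -> 'I_k, forall M,
    exists j : 'I_(s (tau M)), mx_rsim (irr_repr M) (V (tau M) j).
  apply: (fin_all_exists (P := fun M i =>
    exists j : 'I_(s i), mx_rsim (irr_repr M) (V i j))) => M.
  exact: (completeV (Representation (irr_repr M)) (socle_irr M)).
have tauP M M' : equiv_wrt sNG (Representation (irr_repr M))
    (Representation (irr_repr M')) <-> tau M = tau M'.
  have [j sj] := tauV M; have [j' sj'] := tauV M'.
  rewrite -(classV _ j _ j'); split; first exact: equiv_wrt_rsim.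
  by apply: equiv_wrt_rsim; apply: mx_rsim_sym.
have tau_irr_comp i (j : 'I_(s i)) : tau (irr_comp sG (V i j)) = i.
  have [j' sj'] := tauV (irr_comp sG (V i j)).
  apply/esym/(classV _ j _ j'); have sj := rsim_irr_comp_pchar sG F'G (irrV _ j).
  apply: equiv_wrt_rsim (mx_rsim_refl _) _ ((classV _ j _ j).2 erefl).
  exact: mx_rsim_trans sj sj'.
(* T_i is K[G] e_i: each summand of T_i is a Wedderburn subring of class [i], and A e_i is the sum
   of the products of [A] with the identities of these subrings. *)
have memT i A :
    (A \in T i)%MS = (A \in KG)%MS && (A *m block_id tau i == A).
  apply/idP/andP => [/memmx_sumsP[B -> TB] | [GA /eqP <-]].
    have RB j : (B j \in Wedderburn_subring (irr_comp sG (V i j)))%MS.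
      by rewrite -(homogeneous_ideal_irr_comp F'G sG (irrV _ j)).
    split.
      rewrite linear_sum summx_sub // => j _; apply: submx_trans (RB j) _.
      by rewrite -(Wedderburn_sum_pchar sG F'G) (sumsmx_sup (irr_comp sG (V i j))).
    rewrite mulmx_suml; apply/eqP/eq_bigr => j _.
    by rewrite (Wedderburn_subring_block_id F'G tau i (RB j)) tau_irr_comp eqxx.
  rewrite mulmx_sumr linear_sum summx_sub // => M /eqP tM.
  have [j sj] := tauV M; move: j sj; rewrite tM => j sj.
  apply: (sumsmx_sup j) => //.
  rewrite (homogeneous_ideal_irr_comp F'G sG (irrV _ j)).
  rewrite -(irr_comp_rsim_pchar sG F'G sj) irr_reprK_pchar //.
  have /andP[idl _] := Wedderburn_ideal M.
  exact: mulsmx_subP idl _ _ GA (Wedderburn_id_mem M).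
have tau_surj i : exists M, tau M = i.
  by exists (irr_comp sG (V i (j0 i))).
have [defZ dxZ] := center_subgroup_ring_blocks F'G tauP memT.
have rankL i := rank_L_center F'G tauP splitG memT tau_surj i.
(* Clifford's theorem is applied in [V i j] and in [V i j'], linked by a common K[N]-submodule
   [W1]. *)
have orbV i (j j' : 'I_(s i)) (W W' : representation F N) :
    mx_irreducible W -> mx_irreducible W' ->
    iso_submodule W (subg_repr (V i j) sNG) ->
    iso_submodule W' (subg_repr (V i j') sNG) -> same_G_orbit nNG W W'.
  move=> irrW irrW' isoW isoW'.
  have [W1 [irrW1 isoW1 isoW1']] := (classV _ j _ j').2 erefl.
  apply: same_G_orbit_trans (_ : same_G_orbit nNG W W1) _.
    exact: Clifford_same_G_orbit isoW isoW1.
  exact: Clifford_same_G_orbit isoW1' isoW'.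
have coverW (W : representation F N) : mx_irreducible W ->
    exists i (j : 'I_(s i)), iso_submodule W (subg_repr (V i j) sNG).
  move=> irrW; have [M isoWM] := irr_iso_submodule_restriction sNG F'G sG irrW.
  have [j sj] := tauV M; exists (tau M), j.
  exact: iso_submodule_trans isoWM (iso_submodule_subg _ (rsim_iso_submodule sj)).
have V_gt0 i (j : 'I_(s i)) : (0 < rdegree (V i j))%N.
  by have [] := (mx_irrP _).1 (irrV _ j).
split=> //; first exact: (subgroup_ring_blocks F'G tauP memT).
split.
- rewrite defZ (mxdirectP dxZ) /= (eq_bigr (fun=> 1%N)) => [|i _].
    by rewrite sum_nat_const card_ord muln1.
  exact: rankL.
(* The class [i] is represented by a minimal invariant submodule of its first module. *)
- have exA i : exists A : representation F N, minimal_G_invariant nNG A /\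
      iso_submodule A (subg_repr (V i (j0 i)) sNG).
    have [A minA isoA] := minimal_G_invariant_exists (V_gt0 i (j0 i))
      (G_invariant_subg nNG (V i (j0 i))).
    by exists A.
  have [A AP] := boolp.choice exA; exists A; split=> [i | i i' sAA' | B minB].
  + by have [] := AP i.
  + have [[A_gt0 _ _] isoA] := AP i; have [_ isoA'] := AP i'.
    have [W irrW isoWA] := irr_submodule_exists (A i) A_gt0.
    apply/(classV _ (j0 i) _ (j0 i')); exists W; split=> //.
      exact: iso_submodule_trans isoWA isoA.
    apply: iso_submodule_trans isoWA _.
    exact: iso_submodule_trans (rsim_iso_submodule sAA') isoA'.
  (* A simple [W] in [B] occurs in some [V i j], so it is conjugate to a simple [W'] in [A i]. By
     invariance [B] contains [W'] too, and minimal invariant modules sharing [W'] are isomorphic. *)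
  have [B_gt0 invB _] := minB.
  have [W irrW isoWB] := irr_submodule_exists B B_gt0.
  have [i [j isoWV]] := coverW W irrW; exists i.
  have [minA isoA] := AP i; have [A_gt0 invA _] := minA.
  have [W' irrW' isoW'A] := irr_submodule_exists (A i) A_gt0.
  apply: (minimal_G_invariant_rsim F'N irrW' minA minB isoW'A).
  apply: G_invariant_orbit_submodule invB _ isoWB.
  exact: orbV irrW irrW' isoWV (iso_submodule_trans isoW'A isoA).
have exW i : exists W : representation F N, mx_irreducible W /\
    iso_submodule W (subg_repr (V i (j0 i)) sNG).
  by have [W irrW isoW] := irr_submodule_exists (subg_repr (V i (j0 i)) sNG)
    (V_gt0 i (j0 i)); exists W.
have [W WP] := boolp.choice exW; exists W; split=> [i | i i' oWW' | W' irrW'].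
- by have [] := WP i.
(* The restriction of the first module of class [i] is invariant, so with [W i] it contains the
   conjugate [W i'], which links the two classes. *)
- have [irrW isoW] := WP i; have [irrW' isoW'] := WP i'.
  apply/(classV _ (j0 i) _ (j0 i')); exists (W i'); split=> //.
  exact: G_invariant_orbit_submodule (G_invariant_subg nNG _) oWW' isoW.
have [i [j isoW']] := coverW W' irrW'; exists i; have [irrW isoW] := WP i.
exact: orbV isoW isoW'.
Qed.
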